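(* If $\begin{pmatrix}\xi\\ \eta\end{pmatrix}\in\mathbb{C}^2$ is a spinor arising in the canonical hyperbolic structure on $S^3\setminus K$, where $K$ is the figure eight knot (that is, $\begin{pmatrix}\xi\\ \eta\end{pmatrix}$ lies in the orbit of $\begin{pmatrix}1\\0\end{pmatrix}$ under the group $\Gamma\subset \mathrm{SL}_2(\mathbb{C})$), then $\xi$ and $\eta$ are relatively prime Eisenstein integers. Moreover, given a pair of relatively prime Eisenstein integers $(\xi,\eta)$, there exists a unit Eisenstein integer $u$ such that $u\begin{pmatrix}\xi\\ \eta\end{pmatrix}$ is a spinor arising in the canonical hyperbolic structure on $S^3\setminus K$ (that is, lies in the $\Gamma$-orbit of $\begin{pmatrix}1\\0\end{pmatrix}$).
   Context: Let $\omega=-\frac12+\frac{\sqrt3}{2}i$. The ring of Eisenstein integers is $\mathbb{Z}[\omega]$; its units are $\{\pm1,\pm\omega,\pm\omega^2\}$. Two Eisenstein integers are relatively prime if their only common divisors in $\mathbb{Z}[\omega]$ are units. Let $K\subset S^3$ be the figure eight knot. Its knot group is $\pi_1(S^3\setminus K)=\langle x,y\mid y=wxw^{-1}\rangle$ with $w=x^{-1}yxy^{-1}$, and Riley's discrete faithful representation $\rho\colon\pi_1(S^3\setminus K)\to \mathrm{SL}_2(\mathbb{C})$ is given by $$A=\rho(x)=\begin{pmatrix}1&1\\0&1\end{pmatrix},\qquad B=\rho(y)=\begin{pmatrix}1&0\\-\omega&1\end{pmatrix}.$$ Let $\Gamma=\rho(\pi_1(S^3\setminus K))=\langle A,B\rangle\subset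 \mathrm{SL}_2(\mathbb{Z}[\omega])$. The group $\Gamma$ acts on hyperbolic 3-space $\mathbb{H}^3$ through $\mathrm{PSL}_2(\mathbb{C})$ and $S^3\setminus K\cong\mathbb{H}^3/\Gamma$; this is the canonical hyperbolic structure on $S^3\setminus K$. A spinor is a nonzero vector in $\mathbb{C}^2$, written as a column; $\mathrm{SL}_2(\mathbb{C})$ acts on spinors by matrix multiplication. The spinors arising in the canonical hyperbolic structure on $S^3\setminus K$ (the canonical spinors) are by definition those in the $\Gamma$-orbit of $\begin{pmatrix}1\\0\end{pmatrix}$. (Under the $\mathrm{SL}_2(\mathbb{C})$-equivariant bijection between spinors and spin-decorated horospheres in $\mathbb{H}^3$, in the upper half space model, $\begin{pmatrix}1\\0\end{pmatrix}$ corresponds to the horosphere centred at $\infty$ at height $1$ with decoration in the direction $i$, and the spinors in its $\Gamma$-orbit correspond to spin-decorations on the horospheres which are lifts to $\mathbb{H}^3$ of the boundary of the maximal cusp of $S^3\setminus K$.) *)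

(* Defs.v *)
From mathcomp Require Import all_boot all_order all_algebra.
From mathcomp Require Import reals complex ring.
Set Implicit Arguments.
Unset Strict Implicit.
Unset Printing Implicit Defensive.
Import Order.TTheory GRing.Theory Num.Theory.
Local Open Scope ring_scope.
Local Open Scope complex_scope.

(* The field of complex numbers is R[i] with R : realType.  Z[omega] is
   handled as a subset of R[i]. *)

Definition omega (R : realType) : R[i] := (- (1 / 2)) +i* (Num.sqrt 3 / 2).

Definition eisenstein (R : realType) (z : R[i]) : Prop :=
  exists a b : int, z = a%:~R + b%:~R * omega R.

Definition eisenstein_dvd (R : realType) (d z : R[i]) : Prop :=
  exists2 c : R[i], eisenstein c & z = d * c.

Definition eisenstein_unit (R : realType) (u : R[i]) : Prop :=
  eisenstein u /\ exists2 v : R[i], eisenstein v & u * v = 1.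

Definition eisenstein_coprime (R : realType) (x y : R[i]) : Prop :=
  forall d : R[i], eisenstein d ->
    eisenstein_dvd d x -> eisenstein_dvd d y -> eisenstein_unit d.

Definition mx22 (K : Type) (a b c d : K) : 'M[K]_2 :=
  \matrix_(i < 2, j < 2)
    if i == 0 then (if j == 0 then a else b) else (if j == 0 then c else d).

Definition col2 (K : Type) (a b : K) : 'cV[K]_2 :=
  \col_(i < 2) if i == 0 then a else b.

(* The subgroup generated by a set S of matrices; all elements of S are
   meant to be invertible, since invmx is the identity otherwise. *)
Inductive generated (K : fieldType) (n : nat) (S : 'M[K]_n -> Prop) :
    'M[K]_n -> Prop :=
| generated_in g : S g -> generated S g
| generated_1 : generated S 1%:M
| generated_mul g h : generated S g -> generated S h -> generated S (g *m h)
| generated_inv g : generated S g -> generated S (invmx g).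

Definition rileyA (R : realType) : 'M[R[i]]_2 := mx22 1 1 0 1.
Definition rileyB (R : realType) : 'M[R[i]]_2 := mx22 1 0 (- omega R) 1.

(* The image of the figure eight knot group
   < x, y | y = w x w^-1 >, w = x^-1 y x y^-1,
   under Riley's representation x |-> A, y |-> B. *)
Definition figure8_group (R : realType) : 'M[R[i]]_2 -> Prop :=
  generated (fun g => g = rileyA R \/ g = rileyB R).

Definition canonical_spinor (R : realType) (v : 'cV[R[i]]_2) : Prop :=
  exists2 g : 'M[R[i]]_2, figure8_group g & v = g *m col2 1 0.

Lemma omega2 (R : realType) : omega R ^+ 2 = - 1 - omega R.
Proof.
have h : Num.sqrt 3 ^+ 2 = 3 :> R by rewrite sqr_sqrtr.
apply/eqP; rewrite expr2 /omega eq_complex /=; apply/andP; split; apply/eqP.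
- have -> : Num.sqrt 3 / 2 * (Num.sqrt 3 / 2) = Num.sqrt 3 ^+ 2 / 4 :> R by field.
  by rewrite h; field.
- by field.
Qed.

Lemma mul_mx22 (K : nzRingType) (a b c d a' b' c' d' : K) :
  mx22 a b c d *m mx22 a' b' c' d' =
  mx22 (a * a' + b * c') (a * b' + b * d') (c * a' + d * c') (c * b' + d * d').
Proof.
apply/matrixP => i j; rewrite !mxE !big_ord_recl big_ord0 !mxE /= addr0.
by case: (i == 0); case: (j == 0).
Qed.

Lemma det_mx22 (K : comNzRingType) (a b c d : K) :
  \det (mx22 a b c d) = a * d - b * c.
Proof.
rewrite (expand_det_row _ 0) !big_ord_recl big_ord0 /cofactor !det_mx11 !mxE /=.
by rewrite addr0 expr0 expr1 mul1r mulN1r mulrN.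
Qed.

Lemma inv_mx22 (K : fieldType) (a b c d : K) :
  a * d - b * c = 1 -> invmx (mx22 a b c d) = mx22 d (- b) (- c) a.
Proof.
move=> h; have u : mx22 a b c d \in unitmx by rewrite unitmxE det_mx22 h unitr1.
apply: (can_inj (mulKmx u)); rewrite mulmxV // mul_mx22.
apply/matrixP => i j; rewrite !mxE.
case: i => [[|[|i]] // hi]; case: j => [[|[|j]] // hj] /=; rewrite -?h /=; ring.
Qed.

Lemma riley_relation (R : realType) :
  let A := rileyA R in let B := rileyB R in
  let w := invmx A *m B *m A *m invmx B in
  [/\ \det A = 1, \det B = 1 & B = w *m A *m invmx w].
Proof.
have h := omega2 R.
rewrite /= /rileyA /rileyB !det_mx22; split; try by ring.
rewrite !inv_mx22 ?mul_mx22; try ring.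
rewrite inv_mx22; last by ring: h.
by rewrite mul_mx22; congr mx22; ring: h.
Qed.

(* Main.v *)
Require Import Defs.
From mathcomp Require Import all_boot all_order all_algebra.
From mathcomp Require Import reals complex.
From mathcomp Require Import ring zify.
Import Order.TTheory GRing.Theory Num.Theory.
Local Open Scope ring_scope.

(** Write G for the figure eight knot group, generated by
    A = [1, 1; 0, 1] and B = [1, 0; -omega, 1].

    The first half is the remark that G lies in SL_2(Z[omega]): the canonical
    spinor g (1, 0)^T is the first column of g, and the determinant of g is a
    Bezout relation between its two entries.

    The second half is a Euclidean algorithm run inside G.  The orbit of the
    cusp oo under G turns out to contain every Eisenstein integer m
    ([cusp_orbit_eisenstein]); equivalently G contains, for each m, a matrix g
    with first column u (m, 1)^T for some unit u.  For such a g,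

      g^-1 (xi, eta)^T = ( * , - u (xi - m eta))^T,

    so choosing m to be a nearest Eisenstein integer to xi / eta
    ([eisenstein_euclid]) makes the norm of the second coordinate drop
    strictly.  After finitely many steps the second coordinate is 0: every
    pair of Eisenstein integers is delta g (1, 0)^T with g in G and delta an
    Eisenstein integer ([multiple_of_canonical]).  As delta divides both
    entries, it is a unit when they are relatively prime, and u = delta^-1
    is the unit sought.

    That the orbit of oo contains Z[omega] reduces to a finite check, because
    the orbit is invariant under the peripheral subgroup fixing oo: the
    meridian A translates by 1, and the longitude, which is minus the
    translation by 2 sqrt(-3) = 2 + 4 omega ([longitude_in_group]).  These two
    translations have index 4 in Z[omega], and the images of oo under B^-1,
    B A B^-1, B and B A^-1 B^-1 represent the four classes. *)

(** * Arithmetic of the Eisenstein integers *)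

Section EisensteinRing.
Context {R : realType}.
Implicit Types x y z u v : R[i].

Lemma eisenstein_int (k : int) : eisenstein (k%:~R : R[i]).
Proof. by exists k, 0; rewrite mul0r addr0. Qed.

Lemma eisenstein0 : eisenstein (0 : R[i]).
Proof. exact: (eisenstein_int 0). Qed.

Lemma eisenstein1 : eisenstein (1 : R[i]).
Proof. exact: (eisenstein_int 1). Qed.

Lemma eisenstein_omega : eisenstein (omega R).
Proof. by exists 0, 1; rewrite mul1r add0r. Qed.

Lemma eisensteinD x y : eisenstein x -> eisenstein y -> eisenstein (x + y).
Proof.
move=> [a [b ->]] [c [d ->]]; exists (a + c), (b + d).
by rewrite !rmorphD /=; ring.
Qed.

Lemma eisensteinN x : eisenstein x -> eisenstein (- x).
Proof.
by move=> [a [b ->]]; exists (- a), (- b); rewrite !rmorphN /=; ring.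
Qed.

Lemma eisensteinB x y : eisenstein x -> eisenstein y -> eisenstein (x - y).
Proof. by move=> hx hy; apply: eisensteinD => //; apply: eisensteinN. Qed.

Lemma eisensteinM x y : eisenstein x -> eisenstein y -> eisenstein (x * y).
Proof.
move=> [a [b ->]] [c [d ->]]; have h := omega2 R.
exists (a * c - b * d), (a * d + b * c - b * d).
by rewrite !(rmorphD, rmorphB, rmorphM) /=; ring: h.
Qed.

Lemma eisenstein_unit_neq0 {u} : eisenstein_unit u -> u != 0.
Proof.
move=> [_ [v _ uv1]]; apply/eqP => u0; move/eqP: uv1.
by rewrite u0 mul0r eq_sym oner_eq0.
Qed.

Lemma eisenstein_unitV {u} : eisenstein_unit u -> eisenstein_unit u^-1.
Proof.
move=> hu; have u0 := eisenstein_unit_neq0 hu.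
case: hu => [eu [v ev uv1]].
have -> : u^-1 = v by rewrite -[v]mul1r -(mulVf u0) -mulrA uv1 mulr1.
by split=> //; exists u; rewrite // mulrC.
Qed.

Lemma eisenstein_unitN {u} : eisenstein_unit u -> eisenstein_unit (- u).
Proof.
move=> [eu [v ev uv1]]; split; first exact: eisensteinN.
by exists (- v); rewrite ?mulrNN //; apply: eisensteinN.
Qed.

Lemma eisenstein_unit1 : eisenstein_unit (1 : R[i]).
Proof.
by split; [exact: eisenstein1|exists 1; rewrite ?mulr1 //; exact: eisenstein1].
Qed.

Lemma eisenstein_unit_omega : eisenstein_unit (omega R).
Proof.
split; first exact: eisenstein_omega.
exists (omega R ^+ 2); last by have h := omega2 R; ring: h.
by rewrite expr2; apply: eisensteinM; exact: eisenstein_omega.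
Qed.

End EisensteinRing.

(** The norm |a + b omega|^2, computed on coordinates so that descent along it
    takes place in the integers. *)
Definition eisenstein_norm (a b : int) : int := a ^+ 2 - a * b + b ^+ 2.

Lemma four_eisenstein_norm a b :
  4 * eisenstein_norm a b = (2 * a - b) ^+ 2 + 3 * b ^+ 2.
Proof. by rewrite /eisenstein_norm; ring. Qed.

Lemma eisenstein_norm_ge0 a b : 0 <= eisenstein_norm a b.
Proof.
have := four_eisenstein_norm a b.
have := sqr_ge0 (2 * a - b); have := sqr_ge0 b; lia.
Qed.

Lemma eisenstein_norm_eq0 a b : eisenstein_norm a b = 0 -> a = 0 /\ b = 0.
Proof.
move=> n0; have e := four_eisenstein_norm a b.
have := sqr_ge0 (2 * a - b); have := sqr_ge0 b => hb ha.
have /eqP : b ^+ 2 = 0 by lia.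
have /eqP : (2 * a - b) ^+ 2 = 0 by lia.
by rewrite !sqrf_eq0 => /eqP ? /eqP ?; lia.
Qed.

Lemma nearest_multiple {n} (p : int) : 0 < n ->
  exists s : int, - n <= 2 * (p - s * n) <= n.
Proof.
move=> n0; exists ((2 * p + n) %/ (2 * n))%Z.
have n20 : 2 * n != 0 by lia.
have e := divz_eq (2 * p + n) (2 * n).
have := modz_ge0 (2 * p + n) n20.
have := @ltz_pmod (2 * p + n) (2 * n) ltac:(lia).
set s := (_ %/ _)%Z in e *; set t := (_ %% _)%Z in e *.
by nia.
Qed.

(** Rounding both coordinates of a quotient leaves an error e + f omega with
    |e|, |f| <= 1/2, whose norm e^2 - e f + f^2 is at most 3/4; here the error
    is multiplied by n. *)
Lemma small_error {n e f : int} : 0 < n ->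
  - n <= 2 * e <= n -> - n <= 2 * f <= n -> eisenstein_norm e f < n * n.
Proof. by rewrite /eisenstein_norm !expr2 => n0 he hf; nia. Qed.

Lemma eisenstein_euclid {R : realType} {x : R[i]} {c d : int} :
  eisenstein x -> 0 < eisenstein_norm c d ->
  exists2 m : R[i], eisenstein m &
    exists e f : int, [/\ eisenstein_norm e f < eisenstein_norm c d
      & x = m * (c%:~R + d%:~R * omega R) + (e%:~R + f%:~R * omega R)].
Proof.
move=> [a [b ->]] n0; set n := eisenstein_norm c d in n0 *.
(* with y = c + d omega, of norm n and conjugate (c - d) - d omega:
   x / y = x conj(y) / n = (p + q omega) / n *)
pose p := a * (c - d) + b * d; pose q := b * c - a * d.
have [s hs] := nearest_multiple p n0; have [t ht] := nearest_multiple q n0.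
exists (s%:~R + t%:~R * omega R); first by exists s, t.
pose e := a - (s * c - t * d); pose f := b - (s * d + t * c - t * d).
exists e, f; split; last first.
  by have h := omega2 R; rewrite /e /f !(rmorphB, rmorphD, rmorphM) /=; ring: h.
pose p' := p - s * n; pose q' := q - t * n.
(* multiplicativity of the norm, for the remainder times the conjugate of y *)
have normM : eisenstein_norm e f * n = eisenstein_norm p' q'.
  by rewrite /p' /q' /e /f /n /p /q /eisenstein_norm; ring.
by rewrite -(ltr_pM2r n0) normM; apply: small_error.
Qed.

(** * The figure eight group inside SL2 of the Eisenstein integers *)

Section FigureEightGroup.
Context {R : realType}.
Local Notation w := (omega R).
Implicit Types (m u x y : R[i]) (g h : 'M[R[i]]_2) (v : 'cV[R[i]]_2).

Lemma group_integral {g} : figure8_group g -> exists a b c d : R[i],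
  [/\ g = mx22 a b c d, a * d - b * c = 1,
      eisenstein a /\ eisenstein b & eisenstein c /\ eisenstein d].
Proof.
have e0 := eisenstein0 (R := R); have e1 := eisenstein1 (R := R).
have ew := eisenstein_omega (R := R).
elim=> [h [->|->]| |h k _ [a [b [c [d [-> hd [ea eb] [ec ed]]]]]]
    _ [a' [b' [c' [d' [-> hd' [ea' eb'] [ec' ed']]]]]]
  |h _ [a [b [c [d [-> hd [ea eb] [ec ed]]]]]]].
- by exists 1, 1, 0, 1; split=> //; ring.
- exists 1, 0, (- w), 1; split=> //; first by ring.
  by split=> //; apply: eisensteinN.
- exists 1, 0, 0, 1; split=> //; last by ring.
  by apply/matrixP => i j; rewrite !mxE; case: i j => [[|[]]//?] [[|[]]//?].
- do 4!eexists; split; first exact: mul_mx22.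
  + by rewrite -[1]mulr1 -{1}hd -hd'; ring.
  + by split; apply: eisensteinD; apply: eisensteinM.
  + by split; apply: eisensteinD; apply: eisensteinM.
- exists d, (- b), (- c), a; split; first exact: inv_mx22.
  + by rewrite -hd; ring.
  + by split=> //; apply: eisensteinN.
  + by split=> //; apply: eisensteinN.
Qed.

Lemma mx22_col2 (a b c d x y : R[i]) :
  mx22 a b c d *m col2 x y = col2 (a * x + b * y) (c * x + d * y).
Proof.
apply/matrixP => i j; rewrite !mxE !big_ord_recl big_ord0 !mxE /= addr0.
by case: (i == 0).
Qed.

Lemma scale_col2 (a x y : R[i]) : a *: col2 x y = col2 (a * x) (a * y).
Proof. by apply/matrixP => i j; rewrite !mxE; case: (i == 0). Qed.

Lemma col2_inj {x y x' y' : R[i]} : col2 x y = col2 x' y' -> x = x' /\ y = y'.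
Proof. by move=> /matrixP e; split; [move: (e 0 0)|move: (e 1 0)]; rewrite !mxE. Qed.

Lemma group_A : figure8_group (mx22 1 1 0 1 : 'M[R[i]]_2).
Proof. by apply: generated_in; left. Qed.

Lemma group_B : figure8_group (mx22 1 0 (- w) 1).
Proof. by apply: generated_in; right. Qed.

Lemma group_A_inv : figure8_group (mx22 1 (- 1) 0 1 : 'M[R[i]]_2).
Proof.
have <- : invmx (mx22 1 1 0 1) = mx22 1 (- 1) 0 1 :> 'M[R[i]]_2.
  by rewrite inv_mx22 ?oppr0 //; ring.
exact: generated_inv group_A.
Qed.

Lemma group_B_inv : figure8_group (mx22 1 0 w 1).
Proof.
have <- : invmx (mx22 1 0 (- w) 1) = mx22 1 0 w 1.
  by rewrite inv_mx22 ?oppr0 ?opprK //; ring.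
exact: generated_inv group_B.
Qed.

(** The longitude commuting with the meridian A is the palindrome
    B A^-1 B^-1 A . A B^-1 A^-1 B; it acts on the complex plane as the
    translation by 2 + 4 omega = 2 sqrt(-3), and its trace is -2. *)
Lemma longitude_in_group :
  figure8_group (mx22 (- 1) (- (2 + 4 * w)) 0 (- 1)).
Proof.
have h := omega2 R.
have -> : mx22 (- 1) (- (2 + 4 * w)) 0 (- 1) =
    mx22 1 0 (- w) 1 *m mx22 1 (- 1) 0 1 *m mx22 1 0 w 1 *m mx22 1 1 0 1
    *m (mx22 1 1 0 1 *m mx22 1 0 w 1 *m mx22 1 (- 1) 0 1 *m mx22 1 0 (- w) 1).
  by rewrite !mul_mx22; congr mx22; ring: h.
by repeat apply: generated_mul; first
  [exact: group_A|exact: group_B|exact: group_A_inv|exact: group_B_inv].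
Qed.

(** * The orbit of the cusp at infinity *)

(** m is the image of oo under some element of the group: that element has
    first column u (m, 1)^T, and u is a unit because the determinant is 1. *)
Definition in_cusp_orbit m : Prop := exists u b d : R[i],
  eisenstein_unit u /\ figure8_group (mx22 (u * m) b u d).

Lemma in_cusp_orbitI {m a b c d : R[i]} :
  eisenstein_unit c -> a = c * m -> figure8_group (mx22 a b c d) ->
  in_cusp_orbit m.
Proof. by move=> hc -> hg; exists c, b, d. Qed.

Lemma cusp_orbit_translate {m e t : R[i]} :
  eisenstein_unit e -> figure8_group (mx22 e (e * t) 0 e) ->
  in_cusp_orbit m -> in_cusp_orbit (m + t).
Proof.
move=> he ht [u [b [d [hu hg]]]].
have := generated_mul ht hg; rewrite mul_mx22; apply: in_cusp_orbitI.
  rewrite mul0r add0r; case: he hu => [ee [e' he' ee1]] [eu [u' hu' uu1]].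
  split; first exact: eisensteinM.
  exists (e' * u'); first exact: eisensteinM.
  by rewrite -[1]mulr1 -{1}ee1 -uu1; ring.
by ring.
Qed.

(** Negative k are reached through the inverse of the given element; as its
    determinant e^2 is 1, it is again of the form required. *)
Lemma cusp_orbit_translate_int {m e t : R[i]} (k : int) :
  eisenstein_unit e -> figure8_group (mx22 e (e * t) 0 e) ->
  in_cusp_orbit m -> in_cusp_orbit (m + k%:~R * t).
Proof.
move=> he ht hm.
have htN : figure8_group (mx22 e^-1 (e^-1 * - t) 0 e^-1).
  have e0 := eisenstein_unit_neq0 he.
  have [a [b [c [d [E + _ _]]]]] := group_integral ht.
  have -> : a * d - b * c = \det (mx22 e (e * t) 0 e) by rewrite E det_mx22.
  rewrite det_mx22 mulr0 subr0 => ee1.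
  have -> : e^-1 = e by rewrite -[e^-1]mulr1 -ee1 mulKf.
  have := generated_inv ht; rewrite inv_mx22 ?mulr0 ?subr0 //.
  by rewrite oppr0 mulrN.
elim/int_rect: k => [|k IH|k IH]; first by rewrite mul0r addr0.
- have -> : m + (k.+1 : int)%:~R * t = m + k%:~R * t + t.
    by rewrite -addn1 PoszD rmorphD /=; ring.
  exact: cusp_orbit_translate he ht IH.
- have -> : m + (- k.+1%:Z)%:~R * t = m + (- k%:Z)%:~R * t + - t.
    by rewrite -addn1 PoszD opprD rmorphD rmorphN /=; ring.
  exact: cusp_orbit_translate (eisenstein_unitV he) htN IH.
Qed.

(** The meridian and longitude translations reduce a + b omega to a single
    representative in each class of b modulo 4. *)
Lemma cusp_orbit_eisenstein {m} : eisenstein m -> in_cusp_orbit m.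
Proof.
move=> [a [b ->]]; have h := omega2 R.
have u1 := eisenstein_unit1 (R := R); have uw := eisenstein_unit_omega (R := R).
have uwN := eisenstein_unitN uw; have u1N := eisenstein_unitN u1.
have uw2 : eisenstein_unit (1 + w).
  have -> : 1 + w = - w^-1.
    have w0 := eisenstein_unit_neq0 uw; apply: (mulfI w0).
    by rewrite mulrN divff //; ring: h.
  exact/eisenstein_unitN/eisenstein_unitV.
have gA : figure8_group (mx22 1 (1 * 1) 0 1 : 'M[R[i]]_2).
  by rewrite mulr1; exact: group_A.
have gL : figure8_group (mx22 (- 1) (- 1 * (2 + 4 * w)) 0 (- 1)).
  by rewrite mulN1r; exact: longitude_in_group.
have class (k c j : int) : in_cusp_orbit (c%:~R + j%:~R * w) -> b = 4 * k + j ->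
    in_cusp_orbit (a%:~R + b%:~R * w).
  move=> hc ->.
  have := cusp_orbit_translate_int k u1N gL hc.
  move=> /(cusp_orbit_translate_int (a - c - 2 * k) u1 gA).
  congr in_cusp_orbit.
  by rewrite !(rmorphD, rmorphB, rmorphM) /=; ring.
have orbitN1 : in_cusp_orbit ((- 1)%:~R + (- 1)%:~R * w).
  by apply: (in_cusp_orbitI uw _ group_B_inv); ring: h.
have orbit1 : in_cusp_orbit (1%:~R + 1%:~R * w).
  by apply: (in_cusp_orbitI uwN _ group_B); ring: h.
have orbit0 : in_cusp_orbit (1%:~R + 0%:~R * w).
  have := generated_mul (generated_mul group_B group_A) group_B_inv.
  rewrite !mul_mx22; apply: in_cusp_orbitI; last by ring: h.
  have -> // : (- w * 1 + 1 * 0) * 1 + (- w * 1 + 1 * 1) * w = 1 + w.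
  by ring: h.
have orbit2 : in_cusp_orbit (1%:~R + 2%:~R * w).
  have := generated_mul (generated_mul group_B group_A_inv) group_B_inv.
  rewrite !mul_mx22; apply: in_cusp_orbitI; last by ring: h.
  have -> : (- w * 1 + 1 * 0) * 1 + (- w * -1 + 1 * 1) * w = - (1 + w).
    by ring: h.
  exact: eisenstein_unitN.
have [k [r [e r4]]] : exists k r : int, b = 4 * k + r /\ 0 <= r < 4.
  exists (b %/ 4)%Z, (b %% 4)%Z.
  by rewrite mulrC -divz_eq modz_ge0 // ltz_pmod.
have [r_0|[r_1|[r_2|r_3]]] : r = 0 \/ r = 1 \/ r = 2 \/ r = 3 by lia.
- by apply: (class k _ _ orbit0); rewrite e r_0.
- by apply: (class k _ _ orbit1); rewrite e r_1.
- by apply: (class k _ _ orbit2); rewrite e r_2.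
- by apply: (class (k + 1) _ _ orbitN1); rewrite e r_3; ring.
Qed.

(** * Euclidean descent *)

Definition canonical_multiple v : Prop := exists2 delta : R[i],
  eisenstein delta & exists2 g, figure8_group g & v = delta *: (g *m col2 1 0).

Lemma canonical_multiple_mul g v :
  figure8_group g -> canonical_multiple v -> canonical_multiple (g *m v).
Proof.
move=> hg [delta hd [h hh ->]]; exists delta => //.
by exists (g *m h); [exact: generated_mul|rewrite -scalemxAr mulmxA].
Qed.

Lemma canonical_multiple_scale a v :
  eisenstein a -> canonical_multiple v -> canonical_multiple (a *: v).
Proof.
move=> ha [delta hd [h hh ->]]; exists (a * delta); first exact: eisensteinM.
by exists h; rewrite // scalerA.
Qed.

(** The set of multiples of canonical spinors is stable under the group and
    under scaling by Eisenstein integers, so it suffices to move (x, y)^T by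
    these to a vector whose second coordinate is a remainder of x modulo y.
    The multiplier reached at the end is a gcd of x and y. *)
Lemma multiple_of_canonical {x y} :
  eisenstein x -> eisenstein y -> canonical_multiple (col2 x y).
Proof.
move=> ex [c [d ->]] {y}.
have [n le_n] : exists n : nat, eisenstein_norm c d < n%:Z.
  by exists `|eisenstein_norm c d|.+1; have := eisenstein_norm_ge0 c d; lia.
elim: n => [|n IH] in c d x ex le_n *.
  by have := eisenstein_norm_ge0 c d; lia.
have [n0|ngt0|/esym/eisenstein_norm_eq0[-> ->]] :=
  ltgtP 0 (eisenstein_norm c d); last 1 first.
- exists x => //; exists 1%:M; first exact: generated_1.
  by rewrite mul1mx scale_col2 mulr1 mulr0 mul0r addr0.
- have [m em [e [f [lt_ef ->]]]] := eisenstein_euclid ex n0.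
  set y : R[i] := c%:~R + _; set r : R[i] := e%:~R + _.
  have [u [b [k [hu hg]]]] := cusp_orbit_eisenstein em.
  have u0 := eisenstein_unit_neq0 hu.
  have [a' [b' [c' [d' [E hd [_ eb] [_ ed]]]]]] := group_integral hg.
  have /matrixP E' := E.
  move: (E' 0 0) (E' 0 1) (E' 1 0) (E' 1 1); rewrite !mxE /=.
  move=> ? ? ? ?; subst a' b' c' d'.
  have ey : eisenstein y by exists c, d.
  have er : eisenstein r by exists e, f.
  (* (s, r)^T is - u^-1 times the image of (m y + r, y)^T under the inverse of
     [u m, b; u, k] *)
  pose s := - u^-1 * (k * (m * y + r) - b * y).
  have es : eisenstein s.
    apply: eisensteinM.
      by have [+ _] := eisenstein_unitV hu; apply: eisensteinN.
    by apply: eisensteinB; apply: eisensteinM => //; apply: eisensteinD => //;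
       apply: eisensteinM.
  have -> : col2 (m * y + r) y = - u *: (mx22 (u * m) b u k *m col2 s r).
    rewrite mx22_col2 scale_col2 /s; congr col2.
    + transitivity ((u * m * k - b * u) * (m * y + r)); last by field.
      by rewrite hd mul1r.
    + transitivity ((u * m * k - b * u) * y); last by field.
      by rewrite hd mul1r.
  apply: canonical_multiple_scale; first by case: hu => + _; apply: eisensteinN.
  apply: canonical_multiple_mul => //; apply: IH => //.
  by lia.
- by have := eisenstein_norm_ge0 c d; lia.
Qed.

End FigureEightGroup.

(** * Canonical spinors *)

Theorem theorem1p1 (R : realType) :
  (forall xi eta : R[i], canonical_spinor (col2 xi eta) ->
     [/\ eisenstein xi, eisenstein eta & eisenstein_coprime xi eta]) /\
  (forall xi eta : R[i],
     eisenstein xi -> eisenstein eta -> eisenstein_coprime xi eta ->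
     exists2 u : R[i], eisenstein_unit u &
       canonical_spinor (u *: col2 xi eta)).
Proof.
split=> [xi eta [g hg]|xi eta exi eeta cop].
- have [a [b [c [d [-> hd [ea eb] [ec ed]]]]]] := group_integral hg.
  rewrite mx22_col2 !mulr1 !mulr0 !addr0 => /col2_inj[-> ->].
  split=> // delta edelta [p ep ea'] [q eq ec']; split=> //.
  exists (p * d - b * q); first by apply: eisensteinB; apply: eisensteinM.
  by rewrite -hd ea' ec'; ring.
- have [delta edelta [g hg e]] := multiple_of_canonical exi eeta.
  have [a [b [c [d [gE _ [ea _] [ec _]]]]]] := group_integral hg.
  move: (e); rewrite gE mx22_col2 !mulr1 !mulr0 !addr0 scale_col2.
  move=> /col2_inj[xiE etaE].
  have udelta : eisenstein_unit delta.
    by apply: cop => //; [exists a|exists c].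
  exists delta^-1; first exact: eisenstein_unitV.
  exists g => //.
  by rewrite e scalerA mulVf ?scale1r // eisenstein_unit_neq0.
Qed.
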